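(* Let $D$ be a connected strongly graded $S$-ring, $z\in D^1$ a central element and $A:=D/zD$. Suppose that $A^1$ is projective as a left $S$-module. Let $(A\otimes V_*,d_* )$ be a chosen projective resolution of $S$ and ${}^1M_*$ the associated complex, as described in the context. The element $z$ is regular in $D$ if and only if $\mathrm H_1({}^1M_* )$ vanishes and $z$ is $c_{V_3}$-regular.
   Context: $S$ is an associative unital ring, $\otimes=\otimes_S$. A positively graded $S$-ring $D=\bigoplus_{n\ge0}D^n$ is connected if $D^0=S$ and strongly graded if $D^nD^m=D^{n+m}$. Shift: $X(d)^n=X^{n+d}$. Let $\pi:D\to A$ be the projection. $\operatorname{ann}(z)=\{a\in D\mid za=0\}$. The element $z$ is $n$-regular if $\operatorname{ann}(z)\cap D^{\le n}=0$ (vacuous for $n=-1$; for $n=\infty$ it means regular), and regular if $\operatorname{ann}(z)=0$. The complexity $c_V$ of a graded left $S$-module $V$ is $-1$ if $V=0$ and $\sup\{n-1\mid V^n\ne0\}\in\mathbb Z\cup\{\infty\}$ otherwise. Resolution: one fixes a projective resolution of the left $A$-module $S$ $$\cdots\to A\otimes V_n\xrightarrow{d_n}A\otimes V_{n-1}\to\cdots\to A\otimes V_2\xrightarrow{d_2}A\otimes A^1\xrightarrow{d_1}A\xrightarrow{d_0}S\to0$$ where $V_0=S$, $V_1=A^1$ (in degree 1), the $V_n$ are graded projective left $S$-modules, the $d_n$ are graded $A$-linear maps, $d_0$ is the projection onto $A^0=S$, $d_1$ is induced by multiplication, and $V_n^i=0$ for $n\ge2$ and $i=0,1$. Complex ${}^1M_*$: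 put $N_n:=D\otimes V_n$. Choose $\partial_1:N_1\to N_0=D$, $\partial_1(x\otimes a)=x\sigma^1(a)$ with $\sigma^1:A^1\to D^1$ a left $S$-linear section of $\pi^1$; a graded $D$-linear $\partial_2:N_2\to N_1$ with $(\pi\otimes V_1)\partial_2=d_2(\pi\otimes V_2)$; and a graded $D$-linear $f_2:N_2\to N_0(-1)$ with $\partial_1\partial_2=-z\cdot f_2$. Then ${}^1M_*$ is the complex $M_2\xrightarrow{\delta_2}M_1\xrightarrow{\delta_1}M_0\to0$ with $M_0=D$, $M_1=N_1\oplus N_0(-1)$, $M_2=N_2\oplus N_1(-1)$, $\delta_1(x,y)=\partial_1(x)+zy$, $\delta_2(x,y)=(\partial_2(x)-zy,\ \partial_1(y)+f_2(x))$, and $\mathrm H_1({}^1M_* )=\ker\delta_1/\operatorname{im}\delta_2$. *)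

(* Defs.v *)
From HB Require Import structures.
From mathcomp Require Import all_boot all_order all_algebra.
From mathcomp Require Import boolp classical_sets constructive_ereal.

Set Implicit Arguments.
Unset Strict Implicit.
Unset Printing Implicit Defensive.

Import Order.TTheory GRing.Theory Num.Theory.
Local Open Scope classical_set_scope.
Local Open Scope quotient_scope.
Local Open Scope ring_scope.

(* [M] is the internal direct sum of the subgroups [G n], n an integer. *)
Definition is_grading (M : zmodType) (G : int -> set M) : Prop :=
  [/\ forall n, G n 0,
      forall n x y, G n x -> G n y -> G n (x - y),
      forall x, exists (s : seq int) (h : int -> M),
        (forall n, G n (h n)) /\ x = \sum_(n <- s) h n
    & forall (s : seq int) (h : int -> M), uniq s -> (forall n, G n (h n)) ->
        \sum_(n <- s) h n = 0 -> forall n, n \in s -> h n = 0].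

(* The degree [n] part of the shift X(d). *)
Definition shift (M : Type) (G : int -> set M) (d n : int) : set M := G (n + d).

Definition graded_map (M N : Type) (G : int -> set M) (H : int -> set N)
  (f : M -> N) : Prop := forall n x, G n x -> H n (f x).

(* The part of degree at most [n], for [n] an integer or infinite. *)
Definition deg_le (M : zmodType) (G : int -> set M) (n : \bar int) : set M :=
  [set x | exists (s : seq int) (h : int -> M),
     [/\ forall i, G i (h i),
         forall i, i \in s -> (i%:E <= n)%E
       & x = \sum_(i <- s) h i]].

(* A positively graded S-ring: a graded ring, zero in negative degrees, with a
   ring morphism from [S], which necessarily lands in degree 0. *)
Record gradedRing (S : pzRingType) := GradedRing {
  gr_sort :> pzRingType;
  gr_unit : {rmorphism S -> gr_sort};
  gr_comp : int -> set gr_sort;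
  gr_grading : is_grading gr_comp;
  gr_pos : forall n : int, n < 0 -> gr_comp n = [set 0];
  gr_unit0 : forall s, gr_comp 0 (gr_unit s);
  gr_mul : forall n m x y, gr_comp n x -> gr_comp m y -> gr_comp (n + m) (x * y)
}.
Arguments gr_unit {S} g.
Arguments gr_comp {S} g n _.

Definition connected (S : pzRingType) (D : gradedRing S) : Prop :=
  injective (gr_unit D) /\ range (gr_unit D) = gr_comp D 0.

(* The additive subgroup generated by the products of an element of the
   subgroup [X] by an element of the subgroup [Y]. *)
Definition mulset (R : pzRingType) (X Y : set R) : set R :=
  [set x | exists s : seq (R * R),
     (forall p, p \in s -> X p.1 /\ Y p.2) /\ x = \sum_(p <- s) p.1 * p.2].

Definition strongly_graded (S : pzRingType) (D : gradedRing S) : Prop :=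
  forall n m : nat,
    mulset (gr_comp D n%:Z) (gr_comp D m%:Z) = gr_comp D (n%:Z + m%:Z).

Record gradedHom (S : pzRingType) (D A : gradedRing S) := GradedHom {
  gh_fun :> {rmorphism D -> A};
  gh_unit : forall s, gh_fun (gr_unit D s) = gr_unit A s;
  gh_deg : graded_map (gr_comp D) (gr_comp A) gh_fun
}.

(* [pi] exhibits [A] as the graded quotient ring D/zD (for [z] central). *)
Definition is_quotient_by (S : pzRingType) (D A : gradedRing S) (z : D)
  (pi : gradedHom D A) : Prop :=
  [/\ forall a : A, exists x : D, pi x = a,
      forall n, gr_comp A n = pi @` gr_comp D n
    & forall x : D, pi x = 0 <-> exists y : D, x = z * y].

Definition central (R : pzRingType) (z : R) : Prop :=
  forall x : R, z * x = x * z.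

Record gradedModule (S : pzRingType) := GradedModule {
  gm_sort :> lmodType S;
  gm_comp : int -> set gm_sort;
  gm_grading : is_grading gm_comp;
  gm_scale : forall n s v, gm_comp n v -> gm_comp n (s *: v)
}.
Arguments gm_comp {S} g n _.

Definition projective (R : pzRingType) (P : lmodType R) : Prop :=
  forall (M N : lmodType R) (g : {linear M -> N}) (f : {linear P -> N}),
    (forall y, exists x, g x = y) ->
    exists h : {linear P -> M}, forall x, g (h x) = f x.

(* The supremum over the empty set is -1 here, as required when [V] = 0. *)
Definition complexity (S : pzRingType) (V : gradedModule S) : \bar int :=
  supremum (-1)%:E
    [set (n - 1)%:E | n in [set n : int | gm_comp V n <> [set 0]]].

Definition ann (R : pzRingType) (z : R) : set R := [set a | z * a = 0].

Definition regular (R : pzRingType) (z : R) : Prop := ann z = [set 0].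

Definition n_regular (S : pzRingType) (D : gradedRing S) (n : \bar int)
  (z : D) : Prop := ann z `&` deg_le (gr_comp D) n = [set 0].

(* [R] seen as a left S-module through [phi]. *)
Definition restr (S R : pzRingType) (phi : {rmorphism S -> R}) : Type := R.

Section Restr.
Variables (S R : pzRingType) (phi : {rmorphism S -> R}).
HB.instance Definition _ := GRing.Zmodule.copy (restr phi) R.

Let scale (s : S) (x : restr phi) : restr phi := phi s * (x : R).

Fact restr_scaleA a b x : scale a (scale b x) = scale (a * b) x.
Proof. by rewrite /scale rmorphM mulrA. Qed.
Fact restr_scale1 : left_id 1 scale.
Proof. by move=> x; rewrite /scale rmorph1 mul1r. Qed.
Fact restr_scaleDr : right_distributive scale +%R.
Proof. by move=> a x y; rewrite /scale mulrDr. Qed.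
Fact restr_scaleDl x : {morph scale^~ x : a b / a + b}.
Proof. by move=> a b; rewrite /scale rmorphD mulrDl. Qed.

HB.instance Definition _ := GRing.Zmodule_isLmodule.Build S (restr phi)
  restr_scaleA restr_scale1 restr_scaleDr restr_scaleDl.
End Restr.

Definition piece_pred (S : pzRingType) (D : gradedRing S) (n : int) :
  {pred restr (gr_unit D)} := fun x => `[< gr_comp D n x >].
Arguments piece_pred {S} D n _ /.

Section PieceClosed.
Variables (S : pzRingType) (D : gradedRing S) (n : int).

Fact piece_closed : submod_closed (piece_pred D n).
Proof.
have [G0 GB _ _] := gr_grading D.
split=> [|a x y /asboolP Gx /asboolP Gy]; apply/asboolP; first exact: G0.
have Ga : gr_comp D n (gr_unit D a * (x : D)).
  by rewrite -[n]add0r; apply: gr_mul => //; exact: gr_unit0.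
have GN : gr_comp D n (- (y : D)) by rewrite -sub0r; apply: GB.
by have := GB n _ _ Ga GN; rewrite opprK.
Qed.
HB.instance Definition _ :=
  GRing.isSubmodClosed.Build S (restr (gr_unit D)) (piece_pred D n)
    piece_closed.
End PieceClosed.

Definition piece (S : pzRingType) (D : gradedRing S) (n : int) : Type :=
  {x : restr (gr_unit D) | x \in piece_pred D n}.

Section Piece.
Variables (S : pzRingType) (D : gradedRing S) (n : int).
HB.instance Definition _ := SubChoice.on (piece D n).
HB.instance Definition _ := [SubChoice_isSubLmodule of piece D n by <:].
End Piece.

Definition piece_val (S : pzRingType) (D : gradedRing S) (n : int)
  (x : piece D n) : D := val x.

(* The module [M] placed in the single degree [i]. *)
Section Concentrated.
Variables (S : pzRingType) (i : int) (M : lmodType S).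
Definition concentrated_comp (n : int) : set M :=
  if n == i then setT else [set 0].

Fact concentrated_grading : is_grading concentrated_comp.
Proof.
rewrite /concentrated_comp; split.
- by move=> n; case: eqP.
- by move=> n x y; case: eqP => //= _ -> ->; rewrite subr0.
- move=> x; exists [:: i], (fun n => if n == i then x else 0).
  by split=> [n|]; [case: eqP | rewrite big_seq1 eqxx].
- move=> s h us Gh sum0 n ns; case: (eqVneq n i) => [ni|nNi]; last first.
    by have := Gh n; rewrite (negbTE nNi).
  rewrite -sum0 (bigD1_seq n) //= big1 ?addr0 // => m mn.
  by have := Gh m; rewrite -ni (negbTE mn).
Qed.

Fact concentrated_scale n s v :
  concentrated_comp n v -> concentrated_comp n (s *: v).
Proof. by rewrite /concentrated_comp; case: eqP => //= _ ->; rewrite scaler0. Qed.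

Definition concentrated : gradedModule S :=
  GradedModule concentrated_grading concentrated_scale.
End Concentrated.

(* Finite formal sums of pairs (x, v), i.e. lists, modulo the congruence
   generated by permutation and the relations of a tensor product.  The quotient
   is a group, the class of (- x, v) being opposite to that of (x, v). *)
Inductive tens_rel (S R : pzRingType) (phi : {rmorphism S -> R})
    (V : lmodType S) : seq (R * V) -> seq (R * V) -> Prop :=
| tens_refl s : tens_rel phi s s
| tens_sym s t : tens_rel phi s t -> tens_rel phi t s
| tens_trans s t u : tens_rel phi s t -> tens_rel phi t u -> tens_rel phi s u
| tens_cat s s' t t' : tens_rel phi s s' -> tens_rel phi t t' ->
    tens_rel phi (s ++ t) (s' ++ t')
| tens_catC s t : tens_rel phi (s ++ t) (t ++ s)
| tens_nil v : tens_rel phi [:: (0, v)] [::]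
| tens_addl x y v : tens_rel phi [:: (x + y, v)] [:: (x, v); (y, v)]
| tens_addr x v w : tens_rel phi [:: (x, v + w)] [:: (x, v); (x, w)]
| tens_bal x a v : tens_rel phi [:: (x * phi a, v)] [:: (x, a *: v)].

Section TensorType.
Variables (S R : pzRingType) (phi : {rmorphism S -> R}) (V : lmodType S).

Definition tens_relb (s t : seq (R * V)) : bool := `[< tens_rel phi s t >].

Fact tens_relb_equiv : equiv_class_of tens_relb.
Proof.
split=> [s|s t|t s u]; first by apply/asboolP; exact: tens_refl.
- by apply/asboolP/asboolP; exact: tens_sym.
- by move=> /asboolP st /asboolP tu; apply/asboolP; exact: tens_trans st tu.
Qed.
Canonical tens_equiv := EquivRelPack tens_relb_equiv.

Definition tens : Type := {eq_quot tens_equiv}.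
HB.instance Definition _ := Choice.on tens.
HB.instance Definition _ := EqQuotient.on tens.

Definition tcls (s : seq (R * V)) : tens := \pi_tens s.

Lemma tclsP s t : tcls s = tcls t <-> tens_rel phi s t.
Proof.
split=> [/eqmodP/asboolP //|st]; apply/eqmodP; exact/asboolP.
Qed.
Lemma repr_tcls s : tens_rel phi (repr (tcls s)) s.
Proof. by apply/tclsP; rewrite /tcls reprK. Qed.
Lemma tcls_repr t : tcls (repr t) = t.
Proof. by rewrite /tcls reprK. Qed.

Definition tens_zero : tens := tcls [::].
Definition tens_add (t u : tens) : tens := tcls (repr t ++ repr u).
Definition tens_scale (a : R) (t : tens) : tens :=
  tcls [seq (a * p.1, p.2) | p <- repr t].
Definition tens_opp (t : tens) : tens := tens_scale (- 1) t.

Lemma tens_addE s t : tens_add (tcls s) (tcls t) = tcls (s ++ t).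
Proof. by apply/tclsP; apply: tens_cat; exact: repr_tcls. Qed.

Lemma tens_rel_scale a (s t : seq (R * V)) : tens_rel phi s t ->
  tens_rel phi [seq (a * p.1, p.2) | p <- s]
    [seq (a * p.1, p.2) | p <- t].
Proof.
elim=> {s t} /=.
- by move=> s; exact: tens_refl.
- by move=> s t _; exact: tens_sym.
- by move=> s t u _ st _; exact: tens_trans.
- by move=> s s' t t' _ st _ st'; rewrite !map_cat; exact: tens_cat.
- by move=> s t; rewrite !map_cat; exact: tens_catC.
- by move=> v; rewrite mulr0; exact: tens_nil.
- by move=> x y v; rewrite mulrDr; exact: tens_addl.
- by move=> x v w; exact: tens_addr.
- by move=> x b v; rewrite mulrA; exact: tens_bal.
Qed.

Lemma tens_scaleE a s :
  tens_scale a (tcls s) = tcls [seq (a * p.1, p.2) | p <- s].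
Proof. by apply/tclsP/tens_rel_scale/repr_tcls. Qed.

Fact tens_addA : associative tens_add.
Proof.
move=> t u w; rewrite -(tcls_repr t) -(tcls_repr u) -(tcls_repr w).
by rewrite !tens_addE catA.
Qed.
Fact tens_addC : commutative tens_add.
Proof. by move=> t u; apply/tclsP; exact: tens_catC. Qed.
Fact tens_add0 : left_id tens_zero tens_add.
Proof. by move=> t; rewrite -(tcls_repr t) tens_addE. Qed.

Fact tens_scaleA a b t : tens_scale a (tens_scale b t) = tens_scale (a * b) t.
Proof.
rewrite -(tcls_repr t) !tens_scaleE -map_comp; congr tcls.
by apply: eq_map => p /=; rewrite mulrA.
Qed.
Fact tens_scale1 : left_id 1 tens_scale.
Proof.
move=> t; rewrite -(tcls_repr t) tens_scaleE; congr tcls.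
by rewrite -[RHS]map_id; apply: eq_map => -[x v] /=; rewrite mul1r.
Qed.
Fact tens_scaleDr : right_distributive tens_scale tens_add.
Proof.
move=> a t u; rewrite -(tcls_repr t) -(tcls_repr u).
by rewrite tens_addE !tens_scaleE tens_addE map_cat.
Qed.
Fact tens_scaleDl t : {morph tens_scale^~ t : a b / a + b >-> tens_add a b}.
Proof.
move=> a b; rewrite -(tcls_repr t) !tens_scaleE tens_addE.
elim: (repr t) => // p s IHs.
have e (x : R * V) u : tcls (x :: u) = tens_add (tcls [:: x]) (tcls u).
  by rewrite tens_addE.
have ep : tcls [:: ((a + b) * p.1, p.2)] =
    tens_add (tcls [:: (a * p.1, p.2)]) (tcls [:: (b * p.1, p.2)]).
  by rewrite tens_addE mulrDl; apply/tclsP; exact: tens_addl.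
rewrite -tens_addE [LHS]e IHs -tens_addE ep /= !(e _ (map _ _)).
rewrite -!tens_addA; congr tens_add.
by rewrite !tens_addA; congr tens_add; exact: tens_addC.
Qed.
Fact tens_scale0 t : tens_scale 0 t = tens_zero.
Proof.
rewrite -(tcls_repr t) tens_scaleE; elim: (repr t) => //= p s IHs.
rewrite -cat1s -tens_addE IHs mul0r.
have -> : tcls [:: (0, p.2)] = tens_zero by apply/tclsP; exact: tens_nil.
by rewrite tens_add0.
Qed.
Fact tens_addN : left_inverse tens_zero tens_opp tens_add.
Proof.
move=> t; rewrite -[X in tens_add _ X]tens_scale1.
by rewrite /tens_opp -tens_scaleDl addNr tens_scale0.
Qed.

HB.instance Definition _ :=
  GRing.isZmodule.Build tens tens_addA tens_addC tens_add0 tens_addN.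
HB.instance Definition _ := GRing.Zmodule_isLmodule.Build R tens
  tens_scaleA tens_scale1 tens_scaleDr tens_scaleDl.

Definition tpure (x : R) (v : V) : tens := tcls [:: (x, v)].

(* For [f] balanced and biadditive this is the additive map induced by [f]
   on the tensor product, see [tliftD] and [tlift_pure].
   The value does not depend on the chosen representative, see [tlift_cls]. *)
Definition tlift (G : zmodType) (f : R -> V -> G) (t : tens) : G :=
  \sum_(p <- repr t) f p.1 p.2.

Lemma tpureDl x y v : tpure (x + y) v = tpure x v + tpure y v.
Proof. by rewrite /tpure [RHS]tens_addE; apply/tclsP; exact: tens_addl. Qed.
Lemma tpureDr x v w : tpure x (v + w) = tpure x v + tpure x w.
Proof. by rewrite /tpure [RHS]tens_addE; apply/tclsP; exact: tens_addr. Qed.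
Lemma tpure_bal x a v : tpure (x * phi a) v = tpure x (a *: v).
Proof. by apply/tclsP; exact: tens_bal. Qed.
Lemma tpureZ a x v : a *: tpure x v = tpure (a * x) v.
Proof. exact: tens_scaleE. Qed.

Lemma tclsE s : tcls s = \sum_(p <- s) tpure p.1 p.2.
Proof.
elim: s => [|[x v] s IHs]; first by rewrite big_nil.
by rewrite big_cons -IHs -cat1s -tens_addE.
Qed.

Section Lift.
Variables (G : zmodType) (f : R -> V -> G).
Hypothesis fDl : forall x y v, f (x + y) v = f x v + f y v.
Hypothesis fDr : forall x v w, f x (v + w) = f x v + f x w.
Hypothesis f_bal : forall x a v, f (x * phi a) v = f x (a *: v).

Lemma tlift_cls s : tlift f (tcls s) = \sum_(p <- s) f p.1 p.2.
Proof.
rewrite /tlift; move: (repr_tcls s); move: (repr _) => r; elim=> {r s} //=.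
- by move=> s t u _ -> _ ->.
- by move=> s s' t t' _ e _ e'; rewrite !big_cat /= e e'.
- by move=> s t; rewrite !big_cat /= addrC.
- move=> v; rewrite big_seq1 big_nil /=.
  by apply: (@addrI _ (f 0 v)); rewrite -fDl !addr0.
- by move=> x y v; rewrite !big_cons !big_nil !addr0 /= fDl.
- by move=> x v w; rewrite !big_cons !big_nil !addr0 /= fDr.
- by move=> x a v; rewrite !big_seq1 /= f_bal.
Qed.
Lemma tlift_pure x v : tlift f (tpure x v) = f x v.
Proof. by rewrite tlift_cls big_seq1. Qed.
Lemma tliftD t u : tlift f (t + u) = tlift f t + tlift f u.
Proof.
rewrite -(tcls_repr t) -(tcls_repr u) [_ + _]tens_addE !tlift_cls.
by rewrite big_cat.
Qed.
End Lift.
End TensorType.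

Notation tensor D V := (tens (gr_unit D) (gm_sort V)).

Definition tens_comp (S : pzRingType) (D : gradedRing S) (V : gradedModule S)
  (k : int) : set (tensor D V) :=
  [set t | exists s : seq (D * V),
     (forall p, p \in s -> exists i j,
        [/\ gr_comp D i p.1, gm_comp V j p.2 & i + j = k]) /\
     t = \sum_(p <- s) tpure (gr_unit D) p.1 p.2].

(* pi (x) V *)
Definition tmap (S : pzRingType) (D A : gradedRing S) (pi : gradedHom D A)
  (V : gradedModule S) : tensor D V -> tensor A V :=
  tlift (fun (x : D) (v : V) => tpure (gr_unit A) (pi x) v).
Arguments tmap {S D A} pi V _.

Lemma tmap_pure (S : pzRingType) (D A : gradedRing S) (pi : gradedHom D A)
  (V : gradedModule S) x v :
  tmap pi V (tpure (gr_unit D) x v) = tpure (gr_unit A) (pi x) v.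
Proof.
apply: tlift_pure => [x' y w|y w w'|y a w].
- by rewrite rmorphD tpureDl.
- by rewrite tpureDr.
- by rewrite rmorphM gh_unit tpure_bal.
Qed.

(* V_0 = S in degree 0, V_1 = A^1 in degree 1, and V_n = W n for n >= 2 (the
   values W 0 and W 1 are irrelevant). *)
Definition Vseq (S : pzRingType) (A : gradedRing S) (W : nat -> gradedModule S)
  (n : nat) : gradedModule S :=
  match n with
  | 0 => concentrated 0 (S^o : lmodType S)
  | 1 => concentrated 1 (piece A 1 : lmodType S)
  | _ => W n
  end.

(* d_1(a (x) b) = ab, with A (x) V_0 identified with A *)
Definition mult1 (S : pzRingType) (A : gradedRing S) (W : nat -> gradedModule S) :
  tensor A (Vseq A W 1) -> A :=
  tlift (fun (a : A) (b : piece A 1) => a * piece_val b).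
Arguments mult1 {S} A W _.

Lemma piece_valD (S : pzRingType) (D : gradedRing S) n (x y : piece D n) :
  piece_val (x + y) = piece_val x + piece_val y.
Proof. by []. Qed.
Lemma piece_valZ (S : pzRingType) (D : gradedRing S) n s (x : piece D n) :
  piece_val (s *: x) = gr_unit D s * piece_val x.
Proof. by []. Qed.

Lemma mult1_pure (S : pzRingType) (A : gradedRing S) W (a : A) (b : piece A 1) :
  mult1 A W (tpure (gr_unit A) a (b : Vseq A W 1)) = a * piece_val b.
Proof.
apply: (tlift_pure (f := fun (a : A) (b : piece A 1) => a * piece_val b)).
- by move=> x y v; rewrite mulrDl.
- by move=> x v w; rewrite piece_valD mulrDr.
- by move=> x s v; rewrite piece_valZ mulrA.
Qed.

(* [res_d n] is d_(n+2) and [res_d0] is the projection of A onto A^0 = S. *)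
Record resolution (S : pzRingType) (A : gradedRing S) := Resolution {
  res_W : nat -> gradedModule S;
  res_d0 : {additive A -> S};
  res_d : forall n : nat,
    {linear tensor A (Vseq A res_W n.+2) -> tensor A (Vseq A res_W n.+1)};
  res_proj : forall n, (2 <= n)%N -> projective (res_W n);
  res_low : forall n, (2 <= n)%N ->
    gm_comp (res_W n) 0 = [set 0] /\ gm_comp (res_W n) 1 = [set 0];
  res_d0_unit : forall s, res_d0 (gr_unit A s) = s;
  res_d0_pos : forall (n : int) a, 0 < n -> gr_comp A n a -> res_d0 a = 0;
  res_d_deg : forall n, graded_map (@tens_comp S A (Vseq A res_W n.+2))
    (@tens_comp S A (Vseq A res_W n.+1)) (res_d n);
  res_exact0 : [set a | res_d0 a = 0] = range (mult1 A res_W);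
  res_exact1 : [set t | mult1 A res_W t = 0] = range (res_d 0);
  res_exact : forall n, [set t | res_d n t = 0] = range (res_d n.+1)
}.

Definition resV (S : pzRingType) (A : gradedRing S) (P : resolution A) (n : nat) :
  gradedModule S := Vseq A (res_W P) n.

(* x (x) a |-> x sigma(a), with D (x) V_0 identified with D *)
Definition partial1 (S : pzRingType) (D A : gradedRing S) (P : resolution A)
  (sigma : piece A 1 -> piece D 1) : tensor D (resV P 1) -> D :=
  tlift (fun (x : D) (a : piece A 1) => x * piece_val (sigma a)).
Arguments partial1 {S D A} P sigma _.

Lemma partial1_pure (S : pzRingType) (D A : gradedRing S) (P : resolution A)
  (sigma : {linear piece A 1 -> piece D 1}) (x : D) (a : piece A 1) :
  partial1 P sigma (tpure (gr_unit D) x (a : resV P 1)) =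
  x * piece_val (sigma a).
Proof.
apply: (tlift_pure (f := fun (x : D) (a : piece A 1) => x * piece_val (sigma a))).
- by move=> y y' v; rewrite mulrDl.
- by move=> y v w; rewrite raddfD piece_valD mulrDr.
- by move=> y s v; rewrite linearZ piece_valZ mulrA.
Qed.

Record lifting_data (S : pzRingType) (D A : gradedRing S) (z : D)
  (pi : gradedHom D A) (P : resolution A) := LiftingData {
  ld_sigma : {linear piece A 1 -> piece D 1};
  ld_sigmaK : forall a, pi (piece_val (ld_sigma a)) = piece_val a;
  ld_d2 : {linear tensor D (resV P 2) -> tensor D (resV P 1)};
  ld_d2_deg : graded_map (@tens_comp S D (resV P 2)) (@tens_comp S D (resV P 1))
    ld_d2;
  ld_d2_lift : forall t,
    tmap pi (resV P 1) (ld_d2 t) = res_d P 0 (tmap pi (resV P 2) t);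
  ld_f2 : {linear tensor D (resV P 2) -> D^o};
  ld_f2_deg : graded_map (@tens_comp S D (resV P 2)) (shift (gr_comp D) (-1))
    ld_f2;
  ld_f2E : forall t, partial1 P ld_sigma (ld_d2 t) = - (z * ld_f2 t)
}.

Section Complex.
Variables (S : pzRingType) (D A : gradedRing S) (z : D) (pi : gradedHom D A).
Variables (P : resolution A) (L : lifting_data z pi P).

Definition delta1 (m : tensor D (resV P 1) * D) : D :=
  partial1 P (ld_sigma L) m.1 + z * m.2.

Definition delta2 (m : tensor D (resV P 2) * tensor D (resV P 1)) :
  tensor D (resV P 1) * D :=
  (ld_d2 L m.1 - z *: m.2, partial1 P (ld_sigma L) m.2 + ld_f2 L m.1).

(* H_1 = ker delta1 / im delta2 is zero. *)
Definition H1_vanishes : Prop := [set m | delta1 m = 0] `<=` range delta2.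
End Complex.

(* Main.v *)
(* If z is regular, a 1-cycle (x, y) of the complex maps to a 1-cycle of the
   resolution of S over A, so by right exactness of the tensor product x is, up to
   a multiple of z, in the image of partial_2; cancelling z then determines y.

   Conversely, let a in D^n with za = 0 and assume that z is injective in degree
   n - 1.  If n <= c_(V_3) then a = 0 by hypothesis.  Otherwise H_1 = 0 applied to
   the cycle (0, a) gives a = partial_1 w + f_2 t with partial_2 t = zw, and the
   image of t in A (x) V_2 is d_3 u for some u of degree n + 1.  As V_3 vanishes in
   degrees above n and D is generated in degree 1, u is a combination of elements
   u_k of degree n with coefficients b_k in degree 1.  Lifting d_3 u_k to t_k with
   partial_2 t_k = z w_k, the inductive hypothesis gives
   partial_1 w_k + f_2 t_k = 0.  Writing t = sum b_k t_k + zs, one finds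
   a = partial_1 v for v = w - sum b_k w_k - partial_2 s, where zv = 0.  Finally
   v = 0, because A^1 is projective and z is injective in degree n - 1. *)
Require Import Defs.
From HB Require Import structures.
From mathcomp Require Import all_boot all_order all_algebra.
From mathcomp Require Import boolp classical_sets functions constructive_ereal.

Set Implicit Arguments.
Unset Strict Implicit.
Unset Printing Implicit Defensive.

(** * Homogeneous components in a graded group *)

Section HomogeneousComponents.
Local Open Scope ring_scope.
Local Open Scope classical_set_scope.
Import GRing.Theory.
Variables (M : zmodType) (G : int -> set M).

(** Degrees may repeat, so these lists are closed under concatenation. *)
Definition homogeneous_list (l : seq (int * M)) : Prop :=
  forall p, p \in l -> G p.1 p.2.

Section Subgroups.
Hypothesis G0 : forall n, G n 0.
Hypothesis GB : forall n x y, G n x -> G n y -> G n (x - y).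

Lemma subgroup_sum n (I : eqType) (r : seq I) (P : pred I) (F : I -> M) :
  (forall i, i \in r -> P i -> G n (F i)) -> G n (\sum_(i <- r | P i) F i).
Proof.
move=> GF; rewrite big_seq_cond; elim/big_ind: _ => [//|x y Gx Gy|i /andP[ir Pi]].
  by rewrite -[y]opprK -[- y]sub0r; do 2?apply: GB.
exact: GF.
Qed.

Lemma homogeneous_list_part l n : homogeneous_list l ->
  G n (\sum_(p <- l | p.1 == n) p.2).
Proof. by move=> hl; apply: subgroup_sum => p pl /eqP <-; exact: hl. Qed.

Lemma homogeneous_list_sum (s : seq int) (l : seq (int * M)) :
    uniq s -> {subset [seq p.1 | p <- l] <= s} ->
  \sum_(p <- l) p.2 = \sum_(n <- s) \sum_(p <- l | p.1 == n) p.2.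
Proof.
move=> us ls.
rewrite (exchange_big_dep xpredT) //= big_seq [RHS]big_seq.
apply: eq_bigr => p pl; rewrite -big_filter.
rewrite (_ : [seq n <- s | p.1 == n] = [:: p.1]) ?big_seq1 //.
rewrite -(filter_pred1_uniq us); last by apply: ls; apply: map_f.
by apply: eq_filter => n; rewrite /= eq_sym.
Qed.

Lemma homogeneous_list_decomposition l : homogeneous_list l ->
  exists (s : seq int) (h : int -> M),
    (forall n, G n (h n)) /\ \sum_(p <- l) p.2 = \sum_(n <- s) h n.
Proof.
move=> hl; exists (undup [seq p.1 | p <- l]).
exists (fun n => \sum_(p <- l | p.1 == n) p.2).
split=> [n|]; first exact: homogeneous_list_part.
by apply: homogeneous_list_sum => [|n]; rewrite ?undup_uniq ?mem_undup.
Qed.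
End Subgroups.

Hypothesis gG : is_grading G.

Lemma grading0 n : G n 0. Proof. by have [] := gG. Qed.

Lemma gradingB n x y : G n x -> G n y -> G n (x - y).
Proof. by have [_ + _ _] := gG; apply. Qed.

Lemma gradingN n x : G n x -> G n (- x).
Proof. by move=> Gx; rewrite -sub0r; exact: gradingB (grading0 n) Gx. Qed.

Let part := homogeneous_list_part grading0 gradingB.

(** Collecting terms by degree gives a sum over distinct degrees, to which directness of the grading
    applies; a degree absent from [l] has an empty sum. *)
Lemma homogeneous_list_eq0 l : homogeneous_list l -> \sum_(p <- l) p.2 = 0 ->
  forall n, \sum_(p <- l | p.1 == n) p.2 = 0.
Proof.
move=> hl l0 n; have [_ _ _ dG] := gG.
have [nl|nl] := boolP (n \in undup [seq p.1 | p <- l]).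
  apply: (dG (undup [seq p.1 | p <- l])
    (fun n => \sum_(p <- l | p.1 == n) p.2)) nl => [||].
  - exact: undup_uniq.
  - by move=> m; exact: part.
  - rewrite -homogeneous_list_sum ?undup_uniq // => m.
    by rewrite mem_undup.
rewrite big_seq_cond big1 // => p /andP[pl /eqP pn]; case/negP: nl.
by rewrite mem_undup -pn; apply: map_f.
Qed.

Lemma homogeneous_decomposition x :
  exists l, homogeneous_list l /\ x = \sum_(p <- l) p.2.
Proof.
have [_ _ /(_ x)[s [h [Gh ->]]] _] := gG.
exists [seq (n, h n) | n <- s]; rewrite big_map; split=> // p /mapP[n _ ->].
exact: Gh.
Qed.

Definition hcomp (n : int) (x : M) : M :=
  \sum_(p <- sval (cid (homogeneous_decomposition x)) | p.1 == n) p.2.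

(** The decomposition chosen in [hcomp] does not matter: the difference of two decompositions of one
    element is a decomposition of 0. *)
Lemma hcompE l n : homogeneous_list l ->
  hcomp n (\sum_(p <- l) p.2) = \sum_(p <- l | p.1 == n) p.2.
Proof.
move=> hl; rewrite /hcomp; case: cid => l' [hl' /= ll'].
pose m := l' ++ [seq (p.1, - p.2) | p <- l].
have hm : homogeneous_list m.
  move=> p; rewrite mem_cat => /orP[/hl' //|/mapP[q /hl Gq ->]].
  exact: gradingN.
have := homogeneous_list_eq0 hm; rewrite big_cat big_map /= sumrN ll' subrr.
move=> /(_ erefl n); rewrite big_cat big_map /= sumrN => /eqP.
by rewrite subr_eq0 => /eqP.
Qed.

Lemma hcomp_in n x : G n (hcomp n x).
Proof.
have [l [hl ->]] := homogeneous_decomposition x.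
by rewrite hcompE //; exact: part.
Qed.

Lemma hcomp_homogeneous n m x : G n x -> hcomp m x = if m == n then x else 0.
Proof.
move=> Gx; have hx : homogeneous_list [:: (n, x)] by move=> p /[!inE] /eqP ->.
have := hcompE m hx; rewrite big_seq1 => ->.
by rewrite big_mkcond big_seq1 /= eq_sym.
Qed.

Lemma hcomp_id n x : G n x -> hcomp n x = x.
Proof. by move=> /hcomp_homogeneous ->; rewrite eqxx. Qed.

Lemma hcompD n x y : hcomp n (x + y) = hcomp n x + hcomp n y.
Proof.
have [l [hl ->]] := homogeneous_decomposition x.
have [k [hk ->]] := homogeneous_decomposition y.
have hlk : homogeneous_list (l ++ k).
  by move=> p; rewrite mem_cat => /orP[/hl|/hk].
by rewrite -big_cat !hcompE // big_cat.
Qed.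

Lemma hcomp0 n : hcomp n 0 = 0.
Proof. by have := @hcompE [::] n; rewrite !big_nil; apply. Qed.

Lemma sum_hcomp x : exists s0 : seq int, forall s, uniq s -> {subset s0 <= s} ->
  x = \sum_(n <- s) hcomp n x.
Proof.
have [l [hl ->]] := homogeneous_decomposition x.
exists [seq p.1 | p <- l] => s us ls.
rewrite [LHS](homogeneous_list_sum us) //.
by apply: eq_bigr => n _; rewrite hcompE.
Qed.

Lemma hcomp_eq0 x : (forall n, hcomp n x = 0) -> x = 0.
Proof.
move=> x0; have [s xs] := sum_hcomp x.
rewrite (xs (undup s)) ?undup_uniq // ?big1 // => n.
by rewrite mem_undup.
Qed.
End HomogeneousComponents.

(** The shift [d] covers graded maps ([d = 0]), the homotopy [ld_f2] ([d = -1]) and multiplication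
    by [z] ([d = 1]). *)
Lemma hcomp_graded_map (M N : zmodType) (G : int -> set M) (H : int -> set N)
    (gG : is_grading G) (gH : is_grading H) (d : int) (f : M -> N) :
    (forall x y, f (x + y) = f x + f y)%R ->
    (forall n x, G n x -> H (n + d)%R (f x)) ->
  forall n x, hcomp gH (n + d)%R (f x) = f (hcomp gG n x).
Proof.
move=> fD fd n x; have [l [hl ->]] := homogeneous_decomposition gG x.
have f0 : (f 0 = 0)%R by apply: (@GRing.addrI _ (f 0%R)); rewrite -fD !GRing.addr0.
pose l' := [seq ((p.1 + d)%R, f p.2) | p <- l].
have hl' : homogeneous_list H l' by move=> _ /mapP[p /hl Gp ->]; exact: fd.
rewrite hcompE // !(big_morph f fD f0).
have := hcompE gH (n + d)%R hl'; rewrite !big_map /= => ->.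
by apply: eq_bigl => p /=; rewrite (inj_eq (@GRing.addIr _ d)).
Qed.

(** * Dual bases of projective modules *)

Section DualBasis.
Local Open Scope ring_scope.
Import GRing.Theory.
Variables (S : pzRingType) (V : lmodType S).

Lemma eq_sum_support (T : choiceType) (M : zmodType) (F : T -> M) (s s' : seq T) :
    uniq s -> uniq s' -> (forall x, x \notin s -> F x = 0) ->
    (forall x, x \notin s' -> F x = 0) ->
  \sum_(x <- s) F x = \sum_(x <- s') F x.
Proof.
move=> us us' Fs Fs'.
have nz (r : seq T) : \sum_(x <- r) F x = \sum_(x <- r | F x != 0) F x.
  by rewrite (bigID (fun x => F x != 0)) /= addrC big1 ?add0r // => x; rewrite negbK => /eqP.
rewrite nz (nz s') -!(big_filter _ (fun x => F x != 0)); apply: perm_big.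
apply: uniq_perm; rewrite ?filter_uniq // => x; rewrite !mem_filter.
case: eqP => //= Fx; case: (boolP (x \in s)) => [_|/Fs //].
by case: (boolP (x \in s')) => [_|/Fs'].
Qed.

Definition finite_support : {pred V -> S^o} :=
  fun f => `[< exists s : seq V, forall x, x \notin s -> f x = 0 >].

Fact finite_support_closed : submod_closed finite_support.
Proof.
split=> [|a f g /asboolP[s fs] /asboolP[t gt]]; apply/asboolP; first by exists [::].
exists (s ++ t) => x; rewrite mem_cat negb_or => /andP[/fs fx /gt gx].
have -> : (a *: f + g) x = a *: f x + g x by [].
by rewrite fx gx scaler0 addr0.
Qed.
HB.instance Definition _ := GRing.isSubmodClosed.Build S (V -> S^o)
  finite_support finite_support_closed.

(** The free module on the underlying set of [V]; [free_eval] below is its canonical surjection onto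
    [V]. *)
Definition free_module : Type := {f : V -> S^o | f \in finite_support}.
HB.instance Definition _ := SubChoice.on free_module.
HB.instance Definition _ := [SubChoice_isSubLmodule of free_module by <:].

Lemma free_module_support (f : free_module) :
  exists s : seq V, uniq s /\ forall x, x \notin s -> val f x = 0.
Proof.
have /asboolP[s fs] := valP f; exists (undup s); rewrite undup_uniq.
by split=> // x; rewrite mem_undup; exact: fs.
Qed.

Definition free_eval (f : free_module) : V :=
  \sum_(x <- sval (cid (free_module_support f))) (val f x : S) *: x.

Lemma free_evalE (f : free_module) (s : seq V) : uniq s ->
    (forall x, x \notin s -> val f x = 0) ->
  free_eval f = \sum_(x <- s) (val f x : S) *: x.
Proof.
move=> us fs; rewrite /free_eval; case: cid => t [ut ft] /=.
by apply: eq_sum_support => // x; [move/ft|move/fs] => ->; rewrite scale0r.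
Qed.

Fact free_eval_linear : linear free_eval.
Proof.
move=> a f g; have [s [us fs]] := free_module_support f.
have [t [ut gt]] := free_module_support g.
have st x : x \notin undup (s ++ t) -> val f x = 0 /\ val g x = 0.
  by rewrite mem_undup mem_cat negb_or => /andP[/fs fx /gt gx].
have afg x : val (a *: f + g) x = (a * val f x + val g x : S) by [].
have evE (e : free_module) : (forall x, x \notin undup (s ++ t) -> val e x = 0) ->
    free_eval e = \sum_(x <- undup (s ++ t)) (val e x : S) *: x.
  by apply: free_evalE; exact: undup_uniq.
rewrite !evE => [|x /st[] //|x /st[] //|x /st[fx gx]]; last first.
  by rewrite afg fx gx mulr0 addr0.
rewrite scaler_sumr -big_split; apply: eq_bigr => x _ /=.
by rewrite [X in X *: x]afg scalerDl scalerA.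
Qed.
HB.instance Definition _ :=
  GRing.isLinear.Build S free_module V *:%R free_eval free_eval_linear.

Lemma free_eval_surjective (v : V) : exists f, free_eval f = v.
Proof.
pose f : V -> S^o := fun x => if x == v then 1 else 0.
have fP : f \in finite_support.
  apply/asboolP; exists [:: v] => x; rewrite inE /f.
  by case: eqP.
exists (Sub f fP : free_module); rewrite (@free_evalE _ [:: v]) //.
  by rewrite big_seq1 SubK /f eqxx scale1r.
by move=> x; rewrite inE SubK /f; case: eqP.
Qed.

(** Projectivity splits [free_eval], and the coordinates of the splitting are the functionals [h x].
    The expansion holds over every large enough list, so that several vectors can share one list. *)
Lemma projective_dual_basis : projective V ->
  exists h : V -> V -> S^o, (forall x, linear (h x)) /\
    forall v, exists s0 : seq V, forall s, uniq s -> {subset s0 <= s} ->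
    v = \sum_(x <- s) (h x v : S) *: x.
Proof.
move=> pV; have [k hk] := pV _ _ free_eval idfun free_eval_surjective.
exists (fun x v => val (k v) x); split=> [x a u v|]; first by rewrite linearP.
move=> v; have [s0 [us0 ks0]] := free_module_support (k v).
exists s0 => s us s0s; rewrite -[LHS](hk v) /= (@free_evalE _ s) //.
by move=> x xs; apply: ks0; apply: contra xs; exact: s0s.
Qed.
End DualBasis.

(** * Calculus of pure tensors *)

Section PureTensors.
Local Open Scope ring_scope.
Import GRing.Theory.
Variables (S R : pzRingType) (phi : {rmorphism S -> R}) (V : lmodType S).
Local Notation tp := (@tpure S R phi V).

Lemma tpure0l v : tp 0 v = 0.
Proof. by apply: (@addrI _ (tp 0 v)); rewrite -tpureDl !addr0. Qed.

Lemma tpure0r x : tp x 0 = 0.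
Proof. by apply: (@addrI _ (tp x 0)); rewrite -tpureDr !addr0. Qed.

Lemma tpureNl x v : tp (- x) v = - tp x v.
Proof. by apply: (@addrI _ (tp x v)); rewrite -tpureDl !subrr tpure0l. Qed.

Lemma tpureBl x y v : tp (x - y) v = tp x v - tp y v.
Proof. by rewrite tpureDl tpureNl. Qed.

Lemma tpure_suml (I : Type) (r : seq I) (F : I -> R) v :
  tp (\sum_(i <- r) F i) v = \sum_(i <- r) tp (F i) v.
Proof.
exact: (big_morph (fun x => tp x v) (fun x y => tpureDl phi x y v) (tpure0l v)).
Qed.

Lemma tpure_sumr (I : Type) (r : seq I) x (F : I -> V) :
  tp x (\sum_(i <- r) F i) = \sum_(i <- r) tp x (F i).
Proof. exact: (big_morph (tp x) (tpureDr phi x) (tpure0r x)). Qed.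

Lemma tens_sum_pure (t : tens phi V) : exists s : seq (R * V), t = \sum_(p <- s) tp p.1 p.2.
Proof. by exists (repr t); rewrite -tclsE tcls_repr. Qed.

End PureTensors.

(** * The total grading of a tensor product *)

Section TensorGrading.
Local Open Scope ring_scope.
Import GRing.Theory.
Variables (S : pzRingType) (D : gradedRing S) (V : gradedModule S).
Local Notation T := (tensor D V).
Local Notation tp := (@tpure S D (gr_unit D) (gm_sort V)).
Local Notation gD := (gr_grading D).
Local Notation gV := (gm_grading V).

Lemma tens_comp_pure i j x v : gr_comp D i x -> gm_comp V j v ->
  tens_comp (i + j) (tp x v).
Proof.
move=> Dx Vv; exists [:: (x, v)]; rewrite big_seq1; split=> // p.
by rewrite inE => /eqP ->; exists i, j.
Qed.

Lemma tens_comp0 k : tens_comp k (0 : T).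
Proof. by exists [::]; rewrite big_nil. Qed.

Lemma tens_compB k (t u : T) : tens_comp k t -> tens_comp k u -> tens_comp k (t - u).
Proof.
move=> [l [lh ->]] [m [mh ->]].
exists (l ++ [seq (- p.1, p.2) | p <- m]); split.
  move=> p; rewrite mem_cat => /orP[/lh //|/mapP[q /mh[i [j [qi qj <-]]] ->]].
  by exists i, j; split=> //=; apply: gradingN => //; exact: gD.
rewrite big_cat big_map /= -sumrN; congr (_ + _).
by apply: eq_bigr => p _; rewrite tpureNl.
Qed.

Lemma tens_homogeneous_list (t : T) : exists l,
  homogeneous_list (@tens_comp S D V) l /\ t = \sum_(p <- l) p.2.
Proof.
have [s ->] := tens_sum_pure t.
pose Q (u : T) :=
  exists l, homogeneous_list (@tens_comp S D V) l /\ u = \sum_(p <- l) p.2.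
have Q0 : Q 0 by exists [::]; rewrite big_nil.
have QD u u' : Q u -> Q u' -> Q (u + u').
  move=> [l [hl ->]] [l' [hl' ->]]; exists (l ++ l'); rewrite big_cat.
  by split=> // p; rewrite mem_cat => /orP[/hl|/hl'].
apply: (big_ind Q Q0 QD) => -[x v] _ /=.
have [a [ha ->]] := homogeneous_decomposition gD x.
have [b [hb ->]] := homogeneous_decomposition gV v.
rewrite tpure_suml big_seq; apply: (big_ind Q Q0 QD) => p /ha pa.
rewrite tpure_sumr big_seq; apply: (big_ind Q Q0 QD) => q /hb qb.
exists [:: (p.1 + q.1, tp p.2 q.2)]; rewrite big_seq1; split=> // r.
by rewrite inE => /eqP ->; exact: tens_comp_pure.
Qed.

(* The degree [k] projection, valid only on tensors whose [D]-degrees all lie in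
   the finite list [I]. *)
Definition tens_proj (I : seq int) (k : int) : T -> T :=
  tlift (fun x v => \sum_(i <- I) tp (hcomp gD i x) (hcomp gV (k - i) v)).

(** Scalars have degree 0, so taking components is [S]-linear; this makes the formula of [tens_proj]
    balanced. *)
Lemma hcomp_mulr_unit i (x : D) (a : S) :
  hcomp gD i (x * gr_unit D a) = hcomp gD i x * gr_unit D a.
Proof.
rewrite -(@hcomp_graded_map _ _ _ _ gD gD 0 ( *%R^~ (gr_unit D a))) ?addr0 //.
  by move=> y y'; rewrite mulrDl.
by move=> n y Dy; apply: gr_mul => //; exact: gr_unit0.
Qed.

Lemma hcomp_scale i (v : V) (a : S) :
  hcomp gV i (a *: v) = a *: hcomp gV i v.
Proof.
rewrite -(@hcomp_graded_map _ _ _ _ gV gV 0 ( *:%R a)) ?addr0 //.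
  by move=> y y'; rewrite scalerDr.
by move=> n y Vy; rewrite addr0; exact: gm_scale.
Qed.

Lemma tens_proj_pure I k x v : tens_proj I k (tp x v) =
  \sum_(i <- I) tp (hcomp gD i x) (hcomp gV (k - i) v).
Proof.
rewrite /tens_proj (tlift_pure (f := fun x v => \sum_(i <- I)
  tp (hcomp gD i x) (hcomp gV (k - i) v))) //.
- by move=> y y' w; rewrite -big_split; apply: eq_bigr => i _; rewrite hcompD tpureDl.
- by move=> y w w'; rewrite -big_split; apply: eq_bigr => i _; rewrite hcompD tpureDr.
- by move=> y a w; apply: eq_bigr => i _; rewrite hcomp_mulr_unit hcomp_scale tpure_bal.
Qed.

Lemma tens_projD I k t u : tens_proj I k (t + u) = tens_proj I k t + tens_proj I k u.
Proof.
apply: tliftD.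
- by move=> y y' w; rewrite -big_split; apply: eq_bigr => i _; rewrite hcompD tpureDl.
- by move=> y w w'; rewrite -big_split; apply: eq_bigr => i _; rewrite hcompD tpureDr.
- by move=> y a w; apply: eq_bigr => i _; rewrite hcomp_mulr_unit hcomp_scale tpure_bal.
Qed.

Lemma tens_proj0 I k : tens_proj I k 0 = 0.
Proof. by apply: (@addrI _ (tens_proj I k 0)); rewrite -tens_projD !addr0. Qed.

(** A pure tensor of bidegree [(i, j)] survives only in the summand [i], and there exactly when
    [k = i + j]. Hence [I0] collects the [D]-degrees occurring in one expression of [t]. *)
Lemma tens_proj_homogeneous n (t : T) : tens_comp n t ->
  exists I0 : seq int, forall I, uniq I -> {subset I0 <= I} ->
    forall k, tens_proj I k t = if k == n then t else 0.
Proof.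
move=> [s [hs ->]]; elim: s hs => [|[x v] s IHs] hs.
  by exists [::] => I _ _ k; rewrite big_nil tens_proj0 if_same.
have [|I0 hI0] := IHs; first by move=> p ps; apply: hs; rewrite inE ps orbT.
have [i [j [/= Dx Vv ij]]] := hs (x, v) (mem_head _ _).
exists (i :: I0) => I uI sI k; rewrite big_cons tens_projD hI0 //; last first.
  by move=> m mI; apply: sI; rewrite inE mI orbT.
rewrite tens_proj_pure (bigD1_seq i) //=; last by apply: sI; exact: mem_head.
rewrite big1 ?addr0 => [|m /negbTE mi]; last first.
  by rewrite (hcomp_homogeneous gD _ Dx) mi tpure0l.
rewrite (hcomp_id gD Dx) (hcomp_homogeneous gV _ Vv).
rewrite -ij subr_eq [i + j]addrC.
by case: eqP => // _; rewrite ?tpure0r ?addr0.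
Qed.

Lemma tens_grading : is_grading (@tens_comp S D V).
Proof.
split.
- exact: tens_comp0.
- exact: tens_compB.
- move=> t; have [l [hl ->]] := tens_homogeneous_list t.
  exact: (homogeneous_list_decomposition tens_comp0 tens_compB hl).
move=> s h us hh sum0 n ns.
pose I0 m := sval (cid (tens_proj_homogeneous (hh m))).
(* One list of degrees serves all the [h m], so a single additive map isolates [h n] in the sum. *)
pose I := undup (flatten [seq I0 m | m <- s]).
have prE m : m \in s -> tens_proj I n (h m) = if n == m then h m else 0.
  move=> ms; rewrite /I; move: (map_f I0 ms); rewrite {1}/I0; case: cid => J /= hJ Js.
  apply: hJ; first exact: undup_uniq.
  by move=> i iJ; rewrite mem_undup; apply/flattenP; exists J.
have := congr1 (tens_proj I n) sum0; rewrite tens_proj0.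
rewrite (big_morph _ (tens_projD I n) (tens_proj0 I n)) big_seq.
rewrite (eq_bigr _ prE) -big_seq (bigD1_seq n) //= eqxx big1 ?addr0 // => m.
by rewrite eq_sym => /negbTE ->.
Qed.

Lemma tens_comp_scale d n x (t : T) : gr_comp D d x -> tens_comp n t ->
  tens_comp (n + d) (x *: t).
Proof.
move=> Dx [s [hs ->]]; exists [seq (x * p.1, p.2) | p <- s]; split.
  move=> _ /mapP[p /hs[i [j [pi pj <-]]] ->]; exists (d + i), j.
  by split=> //=; [exact: gr_mul | rewrite [RHS]addrC addrA].
rewrite big_map scaler_sumr; apply: eq_bigr => p _; exact: tpureZ.
Qed.

Lemma hcomp_tens_scale d n x (t : T) : gr_comp D d x ->
  hcomp tens_grading (n + d) (x *: t) = x *: hcomp tens_grading n t.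
Proof.
move=> Dx; apply: (@hcomp_graded_map _ _ _ _ tens_grading tens_grading d ( *:%R x)).
  by move=> u u'; rewrite scalerDr.
by move=> m u; exact: tens_comp_scale.
Qed.
End TensorGrading.

(** * Injectivity of [z] on a tensor product with a projective module *)

Section FlatScalars.
Local Open Scope ring_scope.
Import GRing.Theory.
Variables (S : pzRingType) (D : gradedRing S) (V : lmodType S) (d : int).
Local Notation T := (tensor D (concentrated d V)).
Local Notation tp := (@tpure S D (gr_unit D) V).

(** The map induced by [h] on the second factor, with [D] tensor [S] identified with [D]. *)
Definition tens_coord (h : V -> S^o) : T -> D :=
  tlift (fun x v => x * gr_unit D (h v)).

Section Coord.
Variables (h : V -> S^o) (hl : linear h).

Let hD u v : h (u + v) = h u + h v.
Proof. by rewrite -[u]scale1r hl !scale1r. Qed.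

Let h0 : h 0 = 0.
Proof. by apply: (@addrI _ (h 0)); rewrite -hD !addr0. Qed.

Let hZ a v : h (a *: v) = (a * h v : S).
Proof. by rewrite -[a *: v]addr0 hl h0 addr0. Qed.

Let coordDl (x y : D) (v : V) :
  (x + y) * gr_unit D (h v) = x * gr_unit D (h v) + y * gr_unit D (h v).
Proof. by rewrite mulrDl. Qed.

Let coordDr (x : D) (v w : V) :
  x * gr_unit D (h (v + w)) = x * gr_unit D (h v) + x * gr_unit D (h w).
Proof. by rewrite hD rmorphD mulrDr. Qed.

Let coord_bal (x : D) (a : S) (v : V) :
  (x * gr_unit D a) * gr_unit D (h v) = x * gr_unit D (h (a *: v)).
Proof. by rewrite hZ rmorphM mulrA. Qed.

Lemma tens_coord_pure x v : tens_coord h (tp x v) = x * gr_unit D (h v).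
Proof. exact: (tlift_pure coordDl coordDr coord_bal). Qed.

Lemma tens_coordD t u : tens_coord h (t + u) = tens_coord h t + tens_coord h u.
Proof. exact: (tliftD coordDl coordDr coord_bal). Qed.

Lemma tens_coord0 : tens_coord h 0 = 0.
Proof. by apply: (@addrI _ (tens_coord h 0)); rewrite -tens_coordD !addr0. Qed.

Lemma tens_coord_sum (I : Type) (r : seq I) (F : I -> T) :
  tens_coord h (\sum_(i <- r) F i) = \sum_(i <- r) tens_coord h (F i).
Proof. exact: (big_morph _ tens_coordD tens_coord0). Qed.

Lemma tens_coordZ y t : tens_coord h (y *: t) = y * tens_coord h t.
Proof.
have [s ->] := tens_sum_pure t.
rewrite scaler_sumr !tens_coord_sum mulr_sumr; apply: eq_bigr => p _.
by rewrite tpureZ !tens_coord_pure mulrA.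
Qed.

Lemma tens_coord_deg n (t : T) : tens_comp n t ->
  gr_comp D (n - d) (tens_coord h t).
Proof.
move=> [s [hs ->]]; rewrite tens_coord_sum.
have gD := gr_grading D.
apply: (subgroup_sum (grading0 gD) (gradingB gD)) => p /hs[i [j [pi + <-]]] _.
rewrite tens_coord_pure /= /concentrated_comp; case: eqP => [-> _|_ ->].
  by rewrite addrK -[i]addr0; apply: gr_mul => //; exact: gr_unit0.
by rewrite [h _]h0 rmorph0 mulr0; exact: grading0.
Qed.
End Coord.

(** The coordinates along a dual basis determine [t] and commute with left multiplication by [z]. As
    [V] sits in degree [d], they have degree [n - d], where [z] is injective. *)
Lemma projective_scale_inj (z : D) (n : int) : projective V ->
    (forall b, gr_comp D (n - d) b -> z * b = 0 -> b = 0) ->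
  forall t : T, tens_comp n t -> z *: t = 0 -> t = 0.
Proof.
move=> /projective_dual_basis[h [hl hbasis]] zinj t tn zt0.
have coord0 x : tens_coord (h x) t = 0.
  apply: zinj; first exact: tens_coord_deg.
  by rewrite -tens_coordZ // zt0 tens_coord0.
(* Expand the second factor of each pure tensor in the dual basis and move the scalars across;
   allowing every larger list lets the induction merge the lists of its summands. *)
have : exists s0 : seq V, forall s, uniq s -> {subset s0 <= s} ->
    t = \sum_(x <- s) tp (tens_coord (h x) t) x.
  have [l ->] := tens_sum_pure t; elim: l => [|[x v] l [s0 IHl]].
    by exists [::] => s _ _; rewrite big_nil big1 // => x _; rewrite tens_coord0 // tpure0l.
  have [s1 vs1] := hbasis v; exists (s1 ++ s0) => s us ss.
  rewrite big_cons [X in _ + X = _](IHl s) //; last first.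
    by move=> y ys; apply: ss; rewrite mem_cat ys orbT.
  rewrite /= {1}(vs1 s) //; last by move=> y ys; apply: ss; rewrite mem_cat ys.
  rewrite tpure_sumr -big_split; apply: eq_bigr => y _ /=.
  by rewrite tens_coordD // tpureDl tens_coord_pure // tpure_bal.
move=> [s0 /(_ (undup s0) (undup_uniq _))] -> => [|x]; last by rewrite mem_undup.
by rewrite big1 // => x _; rewrite coord0 tpure0l.
Qed.
End FlatScalars.

(** * Passage from [D] to its quotient [A] in tensor products *)

Section QuotientTensor.
Local Open Scope ring_scope.
Import Order.TTheory GRing.Theory Num.Theory.
Variables (S : pzRingType) (D A : gradedRing S) (z : D) (pi : gradedHom D A).
Variable V : gradedModule S.
Local Notation TD := (tensor D V).
Local Notation TA := (tensor A V).
Local Notation tD := (@tpure S D (gr_unit D) (gm_sort V)).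
Local Notation tA := (@tpure S A (gr_unit A) (gm_sort V)).
Local Notation tm := (@tmap S D A pi V).

Lemma tmapD t u : tm (t + u) = tm t + tm u.
Proof.
apply: tliftD => [x' y w|y w w'|y a w].
- by rewrite rmorphD tpureDl.
- by rewrite tpureDr.
- by rewrite rmorphM gh_unit tpure_bal.
Qed.

Lemma tmap0 : tm 0 = 0.
Proof. by apply: (@addrI _ (tm 0)); rewrite -tmapD !addr0. Qed.

Lemma tmapN t : tm (- t) = - tm t.
Proof. by apply: (@addrI _ (tm t)); rewrite -tmapD !subrr tmap0. Qed.

Lemma tmapB t u : tm (t - u) = tm t - tm u.
Proof. by rewrite tmapD tmapN. Qed.

Lemma tmap_sum (I : Type) (r : seq I) (F : I -> TD) :
  tm (\sum_(i <- r) F i) = \sum_(i <- r) tm (F i).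
Proof. exact: (big_morph tm tmapD tmap0). Qed.

Lemma tmapZ x t : tm (x *: t) = pi x *: tm t.
Proof.
have [s ->] := tens_sum_pure t.
rewrite scaler_sumr !tmap_sum scaler_sumr; apply: eq_bigr => p _.
by rewrite tpureZ !tmap_pure tpureZ rmorphM.
Qed.

Lemma tmap_deg n t : tens_comp n t -> tens_comp n (tm t).
Proof.
move=> [s [hs ->]]; exists [seq (pi p.1, p.2) | p <- s]; split.
  move=> _ /mapP[p /hs[i [j [pi1 pj <-]]] ->]; exists i, j; split=> //=.
  exact: gh_deg.
by rewrite big_map tmap_sum; apply: eq_bigr => p _; rewrite tmap_pure.
Qed.

Lemma hcomp_tmap n t : hcomp (tens_grading A V) n (tm t) =
  tm (hcomp (tens_grading D V) n t).
Proof.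
rewrite -[n in LHS]addr0; apply: hcomp_graded_map; first exact: tmapD.
by move=> m u; rewrite addr0; exact: tmap_deg.
Qed.

Hypothesis quo : is_quotient_by z pi.

Lemma quotient_z : pi z = 0.
Proof. by have [_ _ piP] := quo; apply/piP; exists 1; rewrite mulr1. Qed.

Lemma tmap_surj (t : TA) : exists u, tm u = t.
Proof.
have [pi_surj _ _] := quo; have [s ->] := tens_sum_pure t.
elim: s => [|[x v] s [u us]]; first by exists 0; rewrite tmap0 big_nil.
have [y <-] := pi_surj x; exists (tD y v + u).
by rewrite tmapD us big_cons tmap_pure.
Qed.

Lemma tmap_surj_homogeneous n (t : TA) : tens_comp n t ->
  exists2 u : TD, tens_comp n u & tm u = t.
Proof.
have [u <-] := tmap_surj t => tn.
exists (hcomp (tens_grading D V) n u); first exact: hcomp_in.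
by rewrite -hcomp_tmap hcomp_id.
Qed.

(* Right exactness of the tensor product: mapping a formal sum over [A] to a
   formal sum of chosen lifts is well defined modulo z(D (x) V), since the two
   sides of each defining relation have lifts that agree modulo z. *)
Lemma tmap_ker (t : TD) : tm t = 0 -> exists s, t = z *: s.
Proof.
have [pi_surj _ piP] := quo.
pose lift a := sval (cid (pi_surj a)).
have liftK a : pi (lift a) = a by rewrite /lift; case: cid.
pose Q (u : TD) := exists s, u = z *: s.
have Q0 : Q 0 by exists 0; rewrite scaler0.
have QD u v : Q u -> Q v -> Q (u + v).
  by move=> [a ->] [b ->]; exists (a + b); rewrite scalerDr.
have QN u : Q u -> Q (- u) by move=> [a ->]; exists (- a); rewrite scalerN.
have Qp x v : pi x = 0 -> Q (tD x v).
  by move=> /piP[y ->]; exists (tD y v); rewrite tpureZ.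
have QB x y v : pi x = pi y -> Q (tD x v - tD y v).
  by move=> xy; rewrite -tpureBl; apply: Qp; rewrite rmorphB xy subrr.
pose F (l : seq (A * V)) := \sum_(p <- l) tD (lift p.1) p.2.
have F1 x v : F [:: (x, v)] = tD (lift x) v by rewrite /F big_seq1.
have F2 p q : F [:: p; q] = F [:: p] + F [:: q].
  by rewrite /F big_cons !big_seq1.
have Fcat l l' : F (l ++ l') = F l + F l' by rewrite /F big_cat.
have Frel l l' : tens_rel (gr_unit A) l l' -> Q (F l - F l').
  elim=> {l l'}.
  - by move=> l; rewrite subrr.
  - by move=> l l' _ /QN; rewrite opprB.
  - by move=> l l' l'' _ h _ /(QD _ _ h); rewrite addrA subrK.
  - by move=> l l' m m' _ h _ /(QD _ _ h); rewrite !Fcat opprD addrACA.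
  - by move=> l l'; rewrite !Fcat [F l + _]addrC subrr.
  - by move=> v; rewrite F1 /F big_nil subr0; apply: Qp; rewrite liftK.
  - move=> x y v; rewrite F2 !F1 -tpureDl; apply: QB.
    by rewrite rmorphD !liftK.
  - by move=> x v w; rewrite F2 !F1 tpureDr subrr.
  - move=> x a v; rewrite !F1 -tpure_bal; apply: QB.
    by rewrite rmorphM gh_unit !liftK.
have [s ->] := tens_sum_pure t.
rewrite tmap_sum; under eq_bigr do rewrite tmap_pure.
move=> s0; rewrite -/(Q _); pose l := [seq (pi p.1, p.2) | p <- s].
(* Vanishing in the tensor product over [A] means that the formal sum is related to the empty
   one. *)
have /Frel Ql : tens_rel (gr_unit A) l [::].
  by apply/tclsP; rewrite !tclsE big_nil /l big_map.
(* [F l] need not be [t], but each [lift (pi x)] differs from [x] by a multiple of [z]. *)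
rewrite -[X in Q X](subrK (F l)); apply: (QD); last first.
  by move: Ql; rewrite {2}/F big_nil subr0.
rewrite /F /l big_map -sumrN -big_split; apply: (big_ind Q Q0 QD) => p _ /=.
by apply: QB; rewrite liftK.
Qed.

(* [A] is generated in degree 1, so only the summands A^i (x) V^j with i = 0 of
   (A (x) V)^(n+1) can lie outside A^1 (A (x) V)^n. *)
Lemma strongly_graded_tens_comp (n : int) (u : TA) : strongly_graded D ->
    (forall j : int, n < j -> gm_comp V j = [set 0]%classic) -> tens_comp (n + 1) u ->
  exists l : seq (D * TA),
    (forall p, p \in l -> gr_comp D 1 p.1 /\ tens_comp n p.2) /\
    u = \sum_(p <- l) pi p.1 *: p.2.
Proof.
move=> sgD V0 [s [hs ->]]; have [_ piG _] := quo.
pose Q (w : TA) := exists l : seq (D * TA),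
  (forall p, p \in l -> gr_comp D 1 p.1 /\ tens_comp n p.2) /\
  w = \sum_(p <- l) pi p.1 *: p.2.
have Q0 : Q 0 by exists [::]; rewrite big_nil.
have QD w w' : Q w -> Q w' -> Q (w + w').
  move=> [l [hl ->]] [l' [hl' ->]]; exists (l ++ l'); rewrite big_cat.
  by split=> // p; rewrite mem_cat => /orP[/hl|/hl'].
rewrite -/(Q _) big_seq; apply: (big_ind Q Q0 QD) => -[x v] /hs[i [j [/= Ax Vv ij]]].
have [nj|jn] := ltP n j.
  by move: Vv; rewrite V0 // => ->; rewrite tpure0r.
move: Ax; rewrite piG => -[y Dy <-].
(* From [i + j = n + 1] and [j <= n] follows [i >= 1], so strong grading can split off a factor of
   degree 1. *)
have [m im] : exists m : nat, i = 1%:Z + m%:Z.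
  have : (0 <= i - 1)%R by rewrite lerBrDr add0r -(lerD2r j) ij addrC lerD2r.
  by case: (i - 1) (subrK 1 i) => // m <- _; exists m; rewrite addrC.
move: Dy; rewrite im -sgD => -[l [hl ->]]; rewrite rmorph_sum tpure_suml.
rewrite big_seq; apply: (big_ind Q Q0 QD) => -[b c] /hl[/= Db Dc].
exists [:: (b, tA (pi c) v)]; rewrite big_seq1 tpureZ rmorphM; split=> // p.
rewrite inE => /eqP -> /=; split=> //.
have -> : n = m%:Z + j by apply: (@addIr _ 1); rewrite -ij im -addrA addrC.
by apply: tens_comp_pure => //; exact: gh_deg.
Qed.
End QuotientTensor.

(** * The complexity as an upper bound *)

Section Complexity.
Local Open Scope ring_scope.
Local Open Scope classical_set_scope.
Import Order.TTheory GRing.Theory Num.Theory.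

(** [supremum] bounds the set only once a least upper bound is known to exist. It is infinite if no
    integer bounds [E]; otherwise one descends from an integer bound [m] until it is attained. *)
Lemma complexity_ge (S : pzRingType) (V : gradedModule S) (n : int) :
  gm_comp V n <> [set 0] -> ((n - 1)%:E <= complexity V)%O.
Proof.
move=> Vn; rewrite /complexity; set E := image _ _.
have En : E (n - 1)%:E by exists n.
apply: ge_supremum_Nmem => //.
have [[m um]|nub] := pselect (exists m : int, ubound E m%:E); last first.
  exists +oo%E; split=> [x _|[m um||ub]]; rewrite ?leey //.
    by case: nub; exists m.
  by have := ub _ En.
have [k] : exists k : nat, m - (n - 1) = k%:Z.
  have := um _ En; rewrite lee_fin -subr_ge0.
  by case: (m - (n - 1)) => // k _; exists k.
elim: k m um => [|k IHk] m um mk.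
  exists m%:E; split=> // y /(_ _ En).
  by move/eqP: mk; rewrite subr_eq add0r => /eqP ->.
have [Em|nEm] := pselect (E m%:E); first by exists m%:E; split=> // y /(_ _ Em).
apply: (IHk (m - 1)); last by rewrite addrAC mk -addn1 PoszD addrK.
move=> x Ex; have := um _ Ex; have [j Vj xj] := Ex.
rewrite -xj !lee_fin le_eqVlt => /orP[/eqP jm|].
  by case: nEm; rewrite -jm xj.
by rewrite -ltzD1 subrK.
Qed.
End Complexity.

Lemma piece_valP (S : pzRingType) (D : gradedRing S) (n : int) (x : piece D n) :
  gr_comp D n (piece_val x).
Proof. by apply/asboolP; exact: (valP x). Qed.

(** * The complex, its first homology and regularity of [z] *)

Section Main.
Local Open Scope ring_scope.
Local Open Scope classical_set_scope.
Import Order.TTheory GRing.Theory Num.Theory.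
Variables (S : pzRingType) (D A : gradedRing S) (z : D) (pi : gradedHom D A).
Variables (P : resolution A) (L : lifting_data z pi P).
Local Notation gD := (gr_grading D).
Local Notation TD n := (tensor D (resV P n)).
Local Notation p1 := (partial1 P (ld_sigma L)).
Local Notation d2 := (ld_d2 L).
Local Notation f2 := (ld_f2 L).
Local Notation gT n := (tens_grading D (resV P n)).

Let p1Dl (x y : D) (a : piece A 1) : (x + y) * piece_val (ld_sigma L a) =
  x * piece_val (ld_sigma L a) + y * piece_val (ld_sigma L a).
Proof. exact: mulrDl. Qed.

Let p1Dr (x : D) (a b : piece A 1) : x * piece_val (ld_sigma L (a + b)) =
  x * piece_val (ld_sigma L a) + x * piece_val (ld_sigma L b).
Proof. by rewrite raddfD piece_valD mulrDr. Qed.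

Let p1_bal (x : D) (s : S) (a : piece A 1) :
  (x * gr_unit D s) * piece_val (ld_sigma L a) =
  x * piece_val (ld_sigma L (s *: a)).
Proof. by rewrite linearZ piece_valZ mulrA. Qed.

Lemma partial1D t u : p1 (t + u) = p1 t + p1 u.
Proof. exact: (tliftD p1Dl p1Dr p1_bal). Qed.

Lemma partial1_0 : p1 0 = 0.
Proof. by apply: (@addrI _ (p1 0)); rewrite -partial1D !addr0. Qed.

Lemma partial1N t : p1 (- t) = - p1 t.
Proof. by apply: (@addrI _ (p1 t)); rewrite -partial1D !subrr partial1_0. Qed.

Lemma partial1_sum (I : Type) (r : seq I) (F : I -> TD 1) :
  p1 (\sum_(i <- r) F i) = \sum_(i <- r) p1 (F i).
Proof. exact: (big_morph p1 partial1D partial1_0). Qed.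

Lemma partial1Z x t : p1 (x *: t) = x * p1 t.
Proof.
have [s ->] := tens_sum_pure t.
rewrite scaler_sumr !partial1_sum mulr_sumr; apply: eq_bigr => p _.
by rewrite tpureZ !partial1_pure mulrA.
Qed.

Lemma partial1_deg n t : tens_comp n t -> gr_comp D n (p1 t).
Proof.
move=> [s [hs ->]]; rewrite partial1_sum.
apply: (subgroup_sum (grading0 gD) (gradingB gD)).
move=> p /hs[i [j [Dp + <-]]] _; rewrite partial1_pure.
rewrite /= /concentrated_comp; case: eqP => [-> _|_ ->].
  by apply: gr_mul => //; exact: piece_valP.
by rewrite [ld_sigma L _]linear0 mulr0; exact: (grading0 gD).
Qed.

(** [partial1] lifts d_1 because [ld_sigma] is a section of [pi]. *)
Lemma mult1_tmap t : mult1 A (res_W P) (tmap pi (resV P 1) t) = pi (p1 t).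
Proof.
have m1D (u v : tensor A (resV P 1)) :
    mult1 A (res_W P) (u + v) = mult1 A (res_W P) u + mult1 A (res_W P) v.
  apply: (tliftD (f := fun (a : A) (b : piece A 1) => a * piece_val b)).
  - by move=> x y b; rewrite mulrDl.
  - by move=> x b b'; rewrite piece_valD mulrDr.
  - by move=> x s b; rewrite piece_valZ mulrA.
have m10 : mult1 A (res_W P) 0 = 0.
  by apply: (@addrI _ (mult1 A (res_W P) 0)); rewrite -m1D !addr0.
have [s ->] := tens_sum_pure t.
rewrite tmap_sum partial1_sum rmorph_sum (big_morph _ m1D m10).
apply: eq_bigr => p _.
by rewrite tmap_pure mult1_pure partial1_pure rmorphM ld_sigmaK.
Qed.

Lemma f2Z x (t : TD 2) : f2 (x *: t) = x * f2 t.
Proof. by rewrite linearZ. Qed.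

Hypothesis quo : is_quotient_by z pi.

Lemma regular_H1_vanishes : regular z -> H1_vanishes L.
Proof.
move=> zreg [x y]; rewrite /= /delta1 /= => xy0.
have : mult1 A (res_W P) (tmap pi (resV P 1) x) = 0.
  rewrite mult1_tmap -[p1 x](addrK (z * y)) xy0 sub0r rmorphN rmorphM.
  by rewrite (quotient_z quo) mul0r oppr0.
rewrite -[_ = 0]/([set t | mult1 A (res_W P) t = 0] _) res_exact1 => -[t _ tx].
have [t' tt'] := tmap_surj quo t.
have [w xw] : exists w, d2 t' - x = z *: w.
  apply: (tmap_ker quo).
  by rewrite tmapB (ld_d2_lift L) tt' tx subrr.
exists (t', w); rewrite // /delta2 /= -xw opprB addrC subrK; congr pair.
apply/eqP; rewrite -subr_eq0; apply/eqP.
(* Multiplied by [z], this difference becomes [- (p1 x + z * y)], by [ld_f2E], and so vanishes. *)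
suff : ann z (p1 w + f2 t' - y) by rewrite zreg.
rewrite /ann /= mulrBr mulrDr -partial1Z -xw partial1D partial1N ld_f2E.
by rewrite [_ - p1 x + _]addrAC addNr add0r -opprD xy0 oppr0.
Qed.

Hypotheses (z1 : gr_comp D 1 z) (zC : central z) (sgD : strongly_graded D).
Hypothesis A1proj : projective (piece A 1).

Let zscaleC (V : gradedModule S) (x : D) (t : tensor D V) :
  z *: (x *: t) = x *: (z *: t).
Proof. by rewrite !scalerA zC. Qed.

(* An element [u] of (A (x) V_3)^n lifts to a cycle modulo z; if [z] is injective
   in degree n - 1 then this lift and its witness cancel exactly. *)
Lemma lift_res_d1 n (u : tensor A (resV P 3)) :
    (forall b, gr_comp D (n - 1) b -> z * b = 0 -> b = 0) -> tens_comp n u ->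
  exists tw : TD 2 * TD 1,
    [/\ tens_comp (n - 1) tw.2, tmap pi (resV P 2) tw.1 = res_d P 1 u,
        d2 tw.1 = z *: tw.2 & p1 tw.2 + f2 tw.1 = 0].
Proof.
move=> zinj un.
have [t tn tu] := tmap_surj_homogeneous quo (res_d_deg un).
have [w0 d2t] : exists w, d2 t = z *: w.
  apply: (tmap_ker quo); rewrite (ld_d2_lift L) tu.
  suff : range (res_d P 1) (res_d P 1 u) by rewrite -res_exact.
  by exists u.
(* [d2 t] has degree [n] and [z] degree 1, so only this component of [w0] matters. *)
pose w := hcomp (gT 1) (n - 1) w0.
have dtw : d2 t = z *: w.
  rewrite -(hcomp_tens_scale _ _ z1) subrK -d2t hcomp_id //.
  exact: (ld_d2_deg L).
have wn : tens_comp (n - 1) w by exact: hcomp_in.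
(* The sum [p1 w + f2 t] lies in degree [n - 1], since [f2] lowers degrees by one, and [z] kills it
   by [ld_f2E]. *)
exists (t, w); split=> //=; apply: zinj.
  rewrite -[p1 w + _]opprK; apply: (gradingN gD); rewrite opprD.
  apply: (gradingB gD); last exact: (ld_f2_deg L tn).
  by apply: (gradingN gD); exact: partial1_deg.
by rewrite mulrDr -partial1Z -dtw ld_f2E addNr.
Qed.

(** The inductive step of the converse, from degree [n - 1] to degree [n] beyond the complexity of
    V_3. *)
Lemma ann_descent n (a : D) : H1_vanishes L ->
    (forall j : int, n < j -> gm_comp (resV P 3) j = [set 0]) ->
    (forall b, gr_comp D (n - 1) b -> z * b = 0 -> b = 0) ->
  gr_comp D n a -> z * a = 0 -> a = 0.
Proof.
move=> H1 V0 zinj an za.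
have : range (delta2 L) (0, a) by apply: H1; rewrite /= /delta1 /= partial1_0 add0r.
move=> [[t0 w0] _ [e1 e2]].
(* These are the components that contribute to degree [n] in [e2], where [f2] lowers degrees by one,
   and to degree [n + 1] in [e1]. *)
pose t := hcomp (gT 2) (n + 1) t0; pose w := hcomp (gT 1) n w0.
have tn : tens_comp (n + 1) t by exact: hcomp_in.
have wn : tens_comp n w by exact: hcomp_in.
have d2t : d2 t = z *: w.
  rewrite -(hcomp_tens_scale _ _ z1); move/eqP: e1; rewrite subr_eq0.
  move=> /eqP <-; rewrite -[in RHS](addr0 (n + 1)); apply/esym.
  apply: hcomp_graded_map => [x y|m x]; first exact: raddfD.
  by rewrite addr0; exact: (ld_d2_deg L).
have aE : a = p1 w + f2 t.
  rewrite -(hcomp_id gD an) -e2 hcompD; congr (_ + _).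
    rewrite -[in LHS](addr0 n); apply: hcomp_graded_map; first exact: partial1D.
    by move=> m x; rewrite addr0; exact: partial1_deg.
  rewrite -[in LHS](addrK 1 n); apply: hcomp_graded_map; first exact: raddfD.
  exact: (ld_f2_deg L).
(* Since [z] dies in [A], the image of [t] is a cycle for d_2. A preimage under d_3 can be cut down
   to degree [n + 1]. *)
have [u un ut] : exists2 u, tens_comp (n + 1) u &
    res_d P 1 u = tmap pi (resV P 2) t.
  have : [set v | res_d P 0 v = 0] (tmap pi (resV P 2) t).
    by rewrite /= -(ld_d2_lift L) d2t tmapZ (quotient_z quo) scale0r.
  rewrite res_exact => -[u0 _ u0t].
  exists (hcomp (tens_grading A (resV P 3)) (n + 1) u0); first exact: hcomp_in.
  rewrite -[RHS](@hcomp_id _ _ (tens_grading A (resV P 2)) (n + 1)); last exact: tmap_deg.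
  rewrite -u0t -[in RHS](addr0 (n + 1)); apply/esym.
  apply: hcomp_graded_map => [x y|m x]; first exact: raddfD.
  by rewrite addr0; exact: res_d_deg.
have [l [hl uE]] := strongly_graded_tens_comp quo sgD V0 un.
have /choice[tw twP] : forall v, exists tw : TD 2 * TD 1, tens_comp n v ->
    [/\ tens_comp (n - 1) tw.2, tmap pi (resV P 2) tw.1 = res_d P 1 v,
        d2 tw.1 = z *: tw.2 & p1 tw.2 + f2 tw.1 = 0].
  (* The pair [(0, 0)] is a default value outside degree [n], where nothing is claimed. *)
  move=> v; have [vn|nvn] := pselect (tens_comp n v); last by exists (0, 0).
  by have [tw ?] := lift_res_d1 zinj vn; exists tw.
pose tl := \sum_(p <- l) p.1 *: (tw p.2).1; pose wl := \sum_(p <- l) p.1 *: (tw p.2).2.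
(* Both [t] and [tl] lift the image of [u] under d_3. *)
have [s ts] : exists s, t - tl = z *: s.
  apply: (tmap_ker quo); rewrite tmapB -ut uE linear_sum tmap_sum.
  rewrite -sumrB big_seq big1 // => p /hl[_ /twP[_ tp _ _]].
  by rewrite tmapZ tp linearZ subrr.
have d2tl : d2 tl = z *: wl.
  rewrite linear_sum scaler_sumr; apply: eq_big_seq => p /hl[_ /twP[_ _ dp _]].
  by rewrite linearZ zscaleC dp.
have tlE : p1 wl + f2 tl = 0.
  rewrite partial1_sum linear_sum -big_split big_seq big1 // => p.
  move=> /hl[_ /twP[_ _ _ ep]].
  by rewrite partial1Z f2Z /= -mulrDr ep mulr0.
(* The last term is chosen so that [z *: v = d2 (t - tl - z *: s) = 0], while [ld_f2E] turns
   [- p1 (d2 s)] into [f2 (t - tl)]. *)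
pose v := w - wl - d2 s.
have zv : z *: v = 0.
  by rewrite !scalerBr -d2t -d2tl -linearZ -ts raddfB subrr.
have aE' : a = p1 v.
  rewrite /v !partial1D !partial1N ld_f2E opprK -f2Z -ts raddfB aE.
  by move/eqP: tlE; rewrite addr_eq0 => /eqP ->; rewrite opprK addrACA subrr addr0.
(* [s] was not chosen homogeneous; as [a] has degree [n], this component of [v] suffices. *)
pose vn := hcomp (gT 1) n v.
suff vn0 : vn = 0.
  rewrite -(hcomp_id gD an) aE' -[n in LHS]addr0.
  rewrite (@hcomp_graded_map _ _ _ _ (gT 1) gD 0 p1) -/vn ?vn0 ?partial1_0 //.
    exact: partial1D.
  by move=> m x; rewrite addr0; exact: partial1_deg.
apply: (projective_scale_inj A1proj zinj); first exact: hcomp_in.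
by rewrite -(hcomp_tens_scale _ _ z1) zv hcomp0.
Qed.

Lemma H1_vanishes_regular : H1_vanishes L ->
  n_regular (complexity (resV P 3)) z -> regular z.
Proof.
move=> H1 nreg.
(* The induction starts with the negative degrees, where [D] vanishes. *)
have inj N : forall (n : int) a, n < N%:Z -> gr_comp D n a -> z * a = 0 -> a = 0.
  elim: N => [|N IHN] n a nN an za; first by move: an; rewrite gr_pos.
  have [nc|nc] := pselect (n%:E <= complexity (resV P 3))%O.
    suff : (ann z `&` deg_le (gr_comp D) (complexity (resV P 3))) a by rewrite nreg.
    split=> //; exists [:: n], (fun m => if m == n then a else 0).
    split=> [m|m|]; first by case: eqP => // [->|_] //; exact: (grading0 gD).
      by rewrite inE => /eqP ->.
    by rewrite big_seq1 eqxx.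
  apply: (@ann_descent n a H1) => // [j nj|b].
    (* A nonzero component in degree [j > n] would give [n <= j - 1 <= c], with [c] the
       complexity. *)
    apply: contrapT => /complexity_ge cj; apply: nc; apply: le_trans cj.
    by rewrite lee_fin -ltzD1 subrK.
  by apply: IHN; rewrite ltrBlDr -PoszD addn1.
apply/seteqP; split=> [a za|_ ->]; last by rewrite /ann /= mulr0.
(* As [z] is homogeneous, it kills every component of [a]. *)
apply: (@hcomp_eq0 _ _ gD) => n.
apply: (inj (`|n| + 1)%N n); first by rewrite PoszD ltzD1 ler_norm.
  exact: hcomp_in.
rewrite -(@hcomp_graded_map _ _ _ _ gD gD 1 ( *%R z)) ?za ?hcomp0 //.
  by move=> x y; rewrite mulrDr.
by move=> m x xm; rewrite addrC; exact: gr_mul.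
Qed.
End Main.

Theorem theorem3p14 (S : pzRingType) (D A : gradedRing S) (z : gr_sort D)
  (pi : gradedHom D A) (P : resolution A) (L : lifting_data z pi P) :
  connected D -> strongly_graded D ->
  gr_comp D (Posz 1) z -> central z ->
  is_quotient_by z pi ->
  projective (piece A (Posz 1)) ->
  regular z <-> H1_vanishes L /\ n_regular (complexity (resV P 3)) z.
Proof.
move=> _ sgD z1 zC quo A1proj; split=> [zreg|[H1 nreg]]; last first.
  exact: (H1_vanishes_regular (L := L)).
split; first exact: regular_H1_vanishes zreg.
apply/seteqP; split=> [a [az _]|_ ->]; first by rewrite -zreg.
split; first by rewrite zreg.
(* The empty sum puts 0 in the part of degree at most [c] for every [c], even [-1]. *)
exists [::], (fun=> 0%R); split=> [n||]; rewrite ?big_nil //.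
exact: (grading0 (gr_grading D)).
Qed.
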